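(* Let $R$ be a commutative ring with a derivation $D_R$. Let $P$ be a finitely generated projective $R$-module and let $D$ be a derivation of $\operatorname{End}_R(P)$ extending $D_R$. Then there is a differential structure $D_P$ on $P$ such that the derivation of $\operatorname{End}_R(P)$ induced from $D_P$ is $D$, i.e. $D(S)=D_PS-SD_P$ for all $S\in\operatorname{End}_R(P)$.
   Context: A derivation $D$ of an $R$-algebra $E$ extends $D_R$ if $D(r\cdot 1)=D_R(r)\cdot 1$ for all $r\in R$. A differential structure on an $R$-module $P$ is an additive endomorphism $D_P$ of $P$ with $D_P(rp)=D_R(r)p+rD_P(p)$ for all $r\in R$, $p\in P$. It induces on $\operatorname{End}_R(P)$ the derivation $S\mapsto D_PS-SD_P$. *)

(* Defs.v *)
From HB Require Import structures.
From mathcomp Require Import all_boot all_algebra.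
From mathcomp Require Import boolp.

Set Implicit Arguments.
Unset Strict Implicit.
Unset Printing Implicit Defensive.

Import GRing.Theory.
Local Open Scope ring_scope.

(* MathComp's algebra structures exclude the zero ring, so the endomorphism
   algebra, which is zero when P = 0, is given as a pzRingType and an
   lmodType R. *)
Definition endo (R : comPzRingType) (P : lmodType R) : Type := {linear P -> P}.

Section EndomorphismAlgebra.
Variables (R : comPzRingType) (P : lmodType R).
Implicit Types f g h : endo P.

Lemma endoP f g : f =1 g -> f = g.
Proof.
case: f g => [f [[af] [sf]]] [g [[ag] [sg]]] /= /funext efg.
case: g / efg ag sg => ag sg.
by rewrite (Prop_irrelevance af ag) (Prop_irrelevance sf sg).
Qed.

HB.instance Definition _ := gen_eqMixin (endo P).
HB.instance Definition _ := gen_choiceMixin (endo P).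

Definition endo_zero : endo P := (\0 : P -> P).
Definition endo_add f g : endo P := f \+ g.
Definition endo_opp f : endo P := \- f.
Definition endo_one : endo P := (idfun : P -> P).
Definition endo_mul f g : endo P := f \o g.
Definition endo_scale (r : R) f : endo P := r \*: f.

Fact endo_addA : associative endo_add.
Proof. by move=> f g h; apply: endoP => p /=; rewrite addrA. Qed.

Fact endo_addC : commutative endo_add.
Proof. by move=> f g; apply: endoP => p /=; rewrite addrC. Qed.

Fact endo_add0 : left_id endo_zero endo_add.
Proof. by move=> f; apply: endoP => p /=; rewrite add0r. Qed.

Fact endo_addN : left_inverse endo_zero endo_opp endo_add.
Proof. by move=> f; apply: endoP => p /=; rewrite addNr. Qed.

HB.instance Definition _ :=
  GRing.isZmodule.Build (endo P) endo_addA endo_addC endo_add0 endo_addN.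

Fact endo_mulA : associative endo_mul.
Proof. by move=> f g h; apply: endoP. Qed.

Fact endo_mul1l : left_id endo_one endo_mul.
Proof. by move=> f; apply: endoP. Qed.

Fact endo_mul1r : right_id endo_one endo_mul.
Proof. by move=> f; apply: endoP. Qed.

Fact endo_mulDl : left_distributive endo_mul +%R.
Proof. by move=> f g h; apply: endoP. Qed.

Fact endo_mulDr : right_distributive endo_mul +%R.
Proof. by move=> f g h; apply: endoP => p /=; rewrite raddfD. Qed.

HB.instance Definition _ := GRing.Zmodule_isPzRing.Build (endo P)
  endo_mulA endo_mul1l endo_mul1r endo_mulDl endo_mulDr.

Fact endo_scaleA a b f : endo_scale a (endo_scale b f) = endo_scale (a * b) f.
Proof. by apply: endoP => p /=; rewrite scalerA. Qed.

Fact endo_scale1 : left_id 1 endo_scale.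
Proof. by move=> f; apply: endoP => p /=; rewrite scale1r. Qed.

Fact endo_scaleDr : right_distributive endo_scale +%R.
Proof. by move=> a f g; apply: endoP => p /=; rewrite scalerDr. Qed.

Fact endo_scaleDl f : {morph endo_scale^~ f : a b / a + b}.
Proof. by move=> a b; apply: endoP => p /=; rewrite scalerDl. Qed.

HB.instance Definition _ := GRing.Zmodule_isLmodule.Build R (endo P)
  endo_scaleA endo_scale1 endo_scaleDr endo_scaleDl.

Lemma endo0E p : (0 : endo P) p = 0. Proof. by []. Qed.
Lemma endoDE f g p : (f + g) p = f p + g p. Proof. by []. Qed.
Lemma endoNE f p : (- f) p = - f p. Proof. by []. Qed.
Lemma endo1E p : (1 : endo P) p = p. Proof. by []. Qed.
Lemma endoME f g p : (f * g) p = f (g p). Proof. by []. Qed.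
Lemma endoZE r f p : (r *: f) p = r *: f p. Proof. by []. Qed.

Lemma endo_scalerAl r f g : r *: (f * g) = (r *: f) * g.
Proof. by apply: endoP. Qed.

Lemma endo_scalerAr r f g : r *: (f * g) = f * (r *: g).
Proof. by apply: endoP => p; rewrite [RHS]endoME [LHS]endoZE endoZE linearZ. Qed.

End EndomorphismAlgebra.

Definition derivation (E : pzRingType) (D : E -> E) : Prop :=
  (forall x y, D (x + y) = D x + D y) /\
  (forall x y, D (x * y) = D x * y + x * D y).

Definition extends_derivation (R : comPzRingType) (P : lmodType R)
    (DR : R -> R) (D : endo P -> endo P) : Prop :=
  forall r : R, D (r *: (1 : endo P)) = DR r *: (1 : endo P).

Definition finitely_generated (R : pzRingType) (P : lmodType R) : Prop :=
  exists (n : nat) (e : 'I_n -> P),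
    forall p : P, exists c : 'I_n -> R, p = \sum_(i < n) c i *: e i.

Definition projective (R : pzRingType) (P : lmodType R) : Prop :=
  forall (M N : lmodType R) (g : {linear M -> N}) (f : {linear P -> N}),
    (forall y : N, exists x : M, g x = y) ->
    exists h : {linear P -> M}, forall p : P, g (h p) = f p.

Definition differential_structure (R : pzRingType) (P : lmodType R)
    (DR : R -> R) (DP : P -> P) : Prop :=
  (forall p q, DP (p + q) = DP p + DP q) /\
  (forall (r : R) (p : P), DP (r *: p) = DR r *: p + r *: DP p).

(* Main.v *)
From HB Require Import structures.
Require Import Defs.
From mathcomp Require Import all_boot all_algebra.
Set Implicit Arguments.
Unset Strict Implicit.

Import GRing.Theory.
Local Open Scope ring_scope.

(** For a linear form [phi] and [x] in [P], the map [T p := D (phi(.) p) x] is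
    additive and satisfies [T (S p) - S (T p) = phi(x) D(S) p] for every
    endomorphism [S].  The scalars [c] admitting an additive [T] with
    [T (S p) - S (T p) = c D(S) p] form an ideal, which therefore contains the
    trace ideal of [P].  As [P] is finitely generated and is the product of its
    trace ideal with itself, Nakayama's argument gives such a [c] acting on [P]
    as the identity, and the corresponding [T] is the required differential
    structure; its Leibniz rule is the case [S = r 1]. *)

Section RankOne.
Variables (R : comPzRingType) (P : lmodType R) (phi : {scalar P}) (p : P).

Definition rank_one (x : P) : P := phi x *: p.

Fact rank_one_is_linear : linear rank_one.
Proof. by move=> r x y; rewrite /rank_one linearP scalerDl -scalerA. Qed.

HB.instance Definition _ :=
  GRing.isLinear.Build R P P *:%R rank_one rank_one_is_linear.

Definition rank_one_endo : endo P := rank_one.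

End RankOne.

(** Induction on the number of generators, eliminating one at a time, replaces the usual determinant
    of [1 - A]. *)
Lemma nakayama_fixed_scalar (R : comPzRingType) (P : lmodType R)
    (J : R -> Prop) (J0 : J 0) (JD : forall a b, J a -> J b -> J (a + b))
    (JM : forall a b, J b -> J (a * b)) (n : nat) (e : 'I_n -> P)
    (A : 'I_n -> 'I_n -> R) :
    (forall i j, J (A i j)) -> (forall i, e i = \sum_j A i j *: e j) ->
  exists2 t, J t & forall i, t *: e i = e i.
Proof.
elim: n e A => [|n IHn] e A JA eA; first by exists 0 => // -[].
(* Eliminates [e 0] using [(1 - A 0 0) e 0 = \sum_(j > 0) A 0 j *: e j]. *)
pose a := A ord0 ord0.
pose e' i := e (lift ord0 i).
(* Multiply the relation for [e' i] by [1 - a], substitute for [(1 - a) *: e ord0], then add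
   [a *: e' i] to both sides. Every summand keeps a factor in [J]. *)
pose A' i j := (i == j)%:R * a
  + ((1 - a) * A (lift ord0 i) (lift ord0 j)
     + A (lift ord0 i) ord0 * A ord0 (lift ord0 j)).
have e0E : (1 - a) *: e ord0 = \sum_j A ord0 (lift ord0 j) *: e' j.
  by rewrite scalerBl scale1r {1}eA big_ord_recl addrC addKr.
have [i j|i|t Jt te] := IHn e' A'.
- by rewrite /A'; do 2?[apply: (JD)]; apply: (JM); exact: JA.
- under eq_bigr => j _ do rewrite /A' !scalerDl -!scalerA.
  rewrite !big_split /= -!scaler_sumr -e0E.
  rewrite (bigD1 i) //= eqxx scale1r big1 ?addr0; last first.
    by move=> j; rewrite eq_sym => /negPf->; rewrite scale0r.
  have eiE : \sum_j A (lift ord0 i) (lift ord0 j) *: e' j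
      = e' i - A (lift ord0 i) ord0 *: e ord0.
    by rewrite [X in X - _]eA big_ord_recl addrC addKr.
  rewrite eiE scalerBr !scalerA [X in _ - X *: _]mulrC subrK.
  by rewrite -scalerDl addrC subrK scale1r.
(* One minus this scalar is [(1 - t) * (1 - a)]: [1 - a] sends [e ord0] into the span of the [e' i],
   which [1 - t] kills. *)
exists (t + (1 - t) * a).
  by apply: (JD) => //; apply: (JM); exact: JA.
have fixE i : (1 - t) *: ((1 - a) *: e i) = 0 ->
    (t + (1 - t) * a) *: e i = e i.
  rewrite scalerA => z; apply/eqP; rewrite -subr_eq0 -oppr_eq0 opprB; apply/eqP.
  rewrite -{1}[e i]scale1r -scalerBl -z; congr (_ *: _).
  by rewrite mulrBr mulr1 opprD addrA.
have kill i : (1 - t) *: e' i = 0 by rewrite scalerBl scale1r te subrr.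
move=> i; apply: fixE; case: (unliftP ord0 i) => [j|] ->.
  by rewrite scalerA mulrC -scalerA kill scaler0.
rewrite e0E scaler_sumr big1 // => j _.
by rewrite scalerA mulrC -scalerA kill scaler0.
Qed.

(** Projectivity splits the surjection [comb] from row vectors; the coordinates of the splitting are
    the forms. *)
Lemma dual_basis (R : comPzRingType) (P : lmodType R) :
    finitely_generated P -> projective P ->
  exists n (e : 'I_n -> P) (phi : 'I_n -> {scalar P}),
    forall p, p = \sum_i phi i p *: e i.
Proof.
move=> [n [e genP]] projP.
pose comb (v : 'rV[R]_n) : P := \sum_i v 0 i *: e i.
have comb_lin : linear comb.
  move=> r v w; rewrite /comb scaler_sumr -big_split /=.
  by apply: eq_bigr => i _; rewrite !mxE scalerDl scalerA.
pose combL : {linear 'rV[R]_n -> P} :=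
  HB.pack comb (GRing.isLinear.Build _ _ _ _ comb comb_lin).
have [p|h hK] := projP 'rV[R]_n P combL (idfun : {linear P -> P}).
  have [c ->] := genP p; exists (\row_i c i).
  by apply: eq_bigr => i _; rewrite mxE.
pose coord i (p : P) : R := h p 0 i.
have coord_lin i : scalar (coord i).
  by move=> r p q; rewrite /coord linearP !mxE.
pose coordL i : {scalar P} :=
  HB.pack (coord i) (GRing.isLinear.Build _ _ _ _ (coord i) (coord_lin i)).
exists n, e, coordL.
by move=> p; rewrite -[LHS](hK p).
Qed.

Definition scaled_commutator (R : comPzRingType) (P : lmodType R)
    (D : endo P -> endo P) (c : R) (T : P -> P) : Prop :=
  {morph T : p q / p + q} /\
  forall (S : endo P) (p : P), c *: D S p = T (S p) - S (T p).

(** Composing the rank-one map of [p] with [S] gives that of [S p]; apply the product rule and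
    evaluate at [x]. *)
Lemma scaled_commutator_rank_one (R : comPzRingType) (P : lmodType R)
    (D : endo P -> endo P) (phi : {scalar P}) (x : P) :
  derivation D ->
  scaled_commutator D (phi x) (fun p => D (rank_one_endo phi p) x).
Proof.
move=> [DD DM]; split=> [p q|S p].
  rewrite -endoDE -DD; congr (D _ _).
  by apply: endoP => y; rewrite endoDE /= /rank_one scalerDr.
have -> : rank_one_endo phi (S p) = S * rank_one_endo phi p.
  by apply: endoP => y; rewrite endoME /= /rank_one linearZ.
by rewrite DM endoDE !endoME addrK /= /rank_one linearZ.
Qed.

Theorem corollary1 (R : comPzRingType) (DR : R -> R) (hDR : derivation DR)
    (P : lmodType R) (fgP : finitely_generated P) (projP : projective P)
    (D : endo P -> endo P) (hD : derivation D)
    (extD : extends_derivation DR D) :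
  exists DP : P -> P,
    differential_structure DR DP /\
    forall (S : endo P) (p : P), D S p = DP (S p) - S (DP p).
Proof.
have [n [e [phi dualP]]] := dual_basis fgP projP.
(* The relations are the dual basis expansions of the [e i]; rank-one maps put the coefficients
   [phi j (e i)] in the ideal. *)
have [|a b [T [TD TS]] [U [UD US]]|a b [T [TD TS]]|i j|i|t [T [TD TS]] te] :=
  @nakayama_fixed_scalar R P (fun c => exists T, scaled_commutator D c T)
    _ _ _ n e (fun i j => phi j (e i)).
- exists (fun=> 0); split=> [p q|S p]; first by rewrite addr0.
  by rewrite scale0r linear0 subr0.
- exists (fun p => T p + U p); split=> [p q|S p]; first by rewrite TD UD addrACA.
  by rewrite scalerDl TS US linearD opprD addrACA.
- exists (fun p => a *: T p); split=> [p q|S p]; first by rewrite TD scalerDr.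
  by rewrite -scalerA TS scalerBr [S (_ *: _)]linearZ.
- by exists (fun p => D (rank_one_endo (phi j) p) (e i));
    apply: scaled_commutator_rank_one.
- exact: dualP.
have tK (p : P) : t *: p = p.
  rewrite (dualP p) scaler_sumr.
  by apply: eq_bigr => i _; rewrite scalerA mulrC -scalerA te.
have DTS (S : endo P) p : D S p = T (S p) - S (T p) by rewrite -TS tK.
exists T; split=> //; split=> // r p.
have := DTS (r *: (1 : endo P)) p; rewrite extD !endoZE !endo1E => ->.
by rewrite subrK.
Qed.
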